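(* Let $Q>1$ and let $(X,d)$ be a $Q$-doubling length metric space. Suppose that $G\subsetneq X$ is a domain. Then the following hold. (1) $G$ is a length John domain if and only if it is a diameter John domain. (2) The following are equivalent: $G$ is length uniform; $G$ is diameter uniform; $G$ is distance uniform.
   Context: A domain is a nonempty open connected set. For $G\subsetneq X$ put $\delta_G(z)=\inf\{d(z,y): y\in X\setminus G\}$. $B(x,r)=\{y\in X: d(x,y)<r\}$. A curve is a continuous map $\gamma:[a,b]\to X$, identified with its image when convenient; it joins $x$ and $y$ if $\gamma(a)=x$, $\gamma(b)=y$; its length is $\ell(\gamma)=\sup\sum_i d(\gamma(t_i),\gamma(t_{i-1}))$ over all partitions of $[a,b]$, and $\gamma$ is rectifiable if $\ell(\gamma)<\infty$. For points $u,v$ on $\gamma$, $\gamma[u,v]$ is the subcurve with endpoints $u,v$ (points on $\gamma$ are understood together with their parameter values, so for $z=\gamma(t)$, $\gamma[x,z]=\gamma|_{[a,t]}$ and $\gamma[z,y]=\gamma|_{[t,b]}$). Length space: a metric space $(X,d)$ in which every two points can be joined by a rectifiable curve and $d(x,y)=\inf\{\ell(\gamma):\gamma\text{ a rectifiable curve joining }x\text{ and }y\text{ in }X\}$ for all $x,y\in X$. $Q$-doubling: for each ball $B(x,r)$, every $r/2$-separated subset of $B(x,r)$ has cardinality at most $Q$, where a set $S$ is $\sigma$-separated if $d(u,v)\ge\sigma$ for all distinct $u,v\in S$. Let $c\ge1$. Length $c$-John domain: every pair $x,y\in G$ can be joined by a rectifiable curve $\gamma\subset G$ with $\min\{\ell(\gamma[x,z]),\ell(\gamma[z,y])\}\le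 c\,\delta_G(z)$ for all $z\in\gamma$. Diameter $c$-John domain: the same with $\ell$ replaced by $\operatorname{diam}$ in this inequality (the curve is still rectifiable). $G$ is length $c$-uniform if every pair $x,y\in G$ can be joined by a rectifiable curve $\gamma\subset G$ with $\ell(\gamma)\le c\,d(x,y)$ and $\min\{\ell(\gamma[x,z]),\ell(\gamma[z,y])\}\le c\,\delta_G(z)$ for all $z\in\gamma$. $G$ is diameter $c$-uniform if every pair $x,y\in G$ can be joined by a rectifiable curve $\gamma\subset G$ with $\operatorname{diam}(\gamma)\le c\,d(x,y)$ and $\min\{\operatorname{diam}(\gamma[x,z]),\operatorname{diam}(\gamma[z,y])\}\le c\,\delta_G(z)$ for all $z\in\gamma$. $G$ is distance $c$-uniform if every pair $x,y\in G$ can be joined by a rectifiable curve $\gamma\subset G$ with $\operatorname{diam}(\gamma)\le c\,d(x,y)$ and $\min\{d(x,z),d(z,y)\}\le c\,\delta_G(z)$ for all $z\in\gamma$. Omitting $c$ means the property holds for some $c\ge1$. *)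

(* Defs.v *)
From mathcomp Require Import all_boot all_order all_algebra.
From mathcomp Require Import all_classical all_reals.
From mathcomp Require Import ereal topology normedtype numfun.

Set Implicit Arguments.
Unset Strict Implicit.
Unset Printing Implicit Defensive.

Import Order.TTheory GRing.Theory Num.Theory.
Import numFieldNormedType.Exports.

Local Open Scope classical_set_scope.
Local Open Scope ring_scope.

Section MetricNotions.
Context {R : realType} {X : metricType R}.
Implicit Types (x y : X) (A G S : set X) (a b c s : R) (g : R -> X).

Definition separated s S :=
  forall u v, S u -> S v -> u <> v -> s <= mdist u v.

Definition diam A : \bar R :=
  ereal_sup [set (mdist p.1 p.2)%:E | p in A `*` A].

(* This is a true infimum only when the complement of G is nonempty. *)
Definition bdist G x : R := inf [set mdist x y | y in ~` G].

Definition domain G := [/\ G !=set0, open G & connected G].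

(* A curve is given by its endpoints a <= b and a function g on the whole
   line, of which only the restriction to [a, b] matters; the subcurves of
   (a, b, g) at g t are then (a, t, g) and (t, b, g). *)
Definition is_curve a b g := a <= b /\ {within `[a, b], continuous g}.

Definition trace a b g : set X := g @` `[a, b].

(* a :: p lists the points of the partition, as in [itv_partition]. *)
Definition polygonal_length a g (p : seq R) : R :=
  let t := nth a (a :: p) in
  \sum_(0 <= i < size p) mdist (g (t i.+1)) (g (t i)).

Definition curve_length a b g : \bar R :=
  ereal_sup [set (polygonal_length a g p)%:E | p in itv_partition a b].

Definition rectifiable a b g := (curve_length a b g < +oo)%E.

Definition joins x y a b g := g a = x /\ g b = y.

Definition rectifiable_curve_joining x y a b g :=
  [/\ is_curve a b g, rectifiable a b g & joins x y a b g].

Definition rectifiable_curve_joining_in G x y a b g :=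
  rectifiable_curve_joining x y a b g /\ trace a b g `<=` G.

Definition length_john_with c G :=
  forall x y, G x -> G y -> exists a b g,
    rectifiable_curve_joining_in G x y a b g /\
    forall t, t \in `[a, b] ->
      (Order.min (curve_length a t g) (curve_length t b g)
        <= (c * bdist G (g t))%:E)%E.

Definition diam_john_with c G :=
  forall x y, G x -> G y -> exists a b g,
    rectifiable_curve_joining_in G x y a b g /\
    forall t, t \in `[a, b] ->
      (Order.min (diam (trace a t g)) (diam (trace t b g))
        <= (c * bdist G (g t))%:E)%E.

Definition length_uniform_with c G :=
  forall x y, G x -> G y -> exists a b g,
    [/\ rectifiable_curve_joining_in G x y a b g,
        (curve_length a b g <= (c * mdist x y)%:E)%E &
        forall t, t \in `[a, b] ->
          (Order.min (curve_length a t g) (curve_length t b g)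
            <= (c * bdist G (g t))%:E)%E].

Definition diam_uniform_with c G :=
  forall x y, G x -> G y -> exists a b g,
    [/\ rectifiable_curve_joining_in G x y a b g,
        (diam (trace a b g) <= (c * mdist x y)%:E)%E &
        forall t, t \in `[a, b] ->
          (Order.min (diam (trace a t g)) (diam (trace t b g))
            <= (c * bdist G (g t))%:E)%E].

Definition dist_uniform_with c G :=
  forall x y, G x -> G y -> exists a b g,
    [/\ rectifiable_curve_joining_in G x y a b g,
        (diam (trace a b g) <= (c * mdist x y)%:E)%E &
        forall t, t \in `[a, b] ->
          Order.min (mdist x (g t)) (mdist (g t) y) <= c * bdist G (g t)].

Definition length_john G := exists2 c, 1 <= c & length_john_with c G.
Definition diam_john G := exists2 c, 1 <= c & diam_john_with c G.
Definition length_uniform G := exists2 c, 1 <= c & length_uniform_with c G.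
Definition diam_uniform G := exists2 c, 1 <= c & diam_uniform_with c G.
Definition dist_uniform G := exists2 c, 1 <= c & dist_uniform_with c G.

End MetricNotions.

Definition length_space {R : realType} (X : metricType R) :=
  forall x y : X,
    (exists a b g, rectifiable_curve_joining x y a b g) /\
    (mdist x y)%:E = ereal_inf
      [set l | exists a b g,
         rectifiable_curve_joining x y a b g /\ l = curve_length a b g].

Definition doubling {R : realType} (Q : R) (X : metricType R) :=
  forall (x : X) (r : R), 0 < r ->
    forall S : set X, S `<=` ball x r -> separated (r / 2) S ->
      exists2 n : nat, (S #= `I_n)%card & n%:R <= Q.

(* Main.v *)
(* The converse implications are proved by rebuilding the curve. Call [carrot]
   a curve from x along which the length covered so far is at most
   C * bdist; two carrots from x and y to a common point form a curve as in
   the length conditions. A carrot is a chain of pieces, one for each dyadic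
   distance r from x, of length O(r) and with bdist at least of order r.

   A piece comes from a connected set E of diameter O(r) on which bdist is at
   least of order r. A shortest s-chain in E, with s a small multiple of r, has
   boundedly many points, since every other point of it gives an s-separated
   family; in a length space its steps can be replaced by short curves.

   For a diameter John curve, E is the subcurve between the first points at
   distance r/2 and r from x. For a distance uniform domain, the curve from x
   to y is only used to find a point at distance r from x which is far from
   the boundary, and E is a curve, again given by uniformity, which joins the
   points found for r/2 and r. *)

Require Import Defs.
From mathcomp Require Import all_boot all_order all_algebra.
From mathcomp Require Import all_classical all_reals.
From mathcomp Require Import ereal topology normedtype numfun.
From mathcomp Require Import ring lra.

Set Implicit Arguments.
Unset Strict Implicit.
Unset Printing Implicit Defensive.

Import Order.TTheory GRing.Theory Num.Theory.
Import numFieldNormedType.Exports.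

Local Open Scope classical_set_scope.
Local Open Scope ring_scope.

(** * Length of curves *)

Section CurveLength.
Context {R : realType} {X : metricType R}.
Implicit Types (a b c t L : R) (g h : R -> X) (p : seq R) (u v w x y : X).

Lemma polygonal_length_cons a g t p :
  polygonal_length a g (t :: p) = mdist (g t) (g a) + polygonal_length t g p.
Proof.
rewrite /polygonal_length /= big_nat_recl//=; congr (_ + _).
by apply: eq_big_nat => i /andP[_ ip]; congr (mdist (g _) (g _));
  apply: set_nth_default => //=; exact: ltnW.
Qed.

Lemma polygonal_length_nil a g : polygonal_length a g [::] = 0.
Proof. by rewrite /polygonal_length big_nil. Qed.

Lemma polygonal_length_rcons a g p t :
  polygonal_length a g (rcons p t) =
  polygonal_length a g p + mdist (g t) (g (last a p)).
Proof.
elim: p a => [|s p IH] a /=.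
  by rewrite polygonal_length_cons !polygonal_length_nil addrC.
by rewrite !polygonal_length_cons IH addrA.
Qed.

(** Repeated points add zero length, so weakly increasing sequences may stand in for the strict
    partitions of [itv_partition]. Images under monotone maps can then be used directly. *)
Lemma polygonal_length_strict a g p : path <=%R a p ->
  exists2 q, itv_partition a (last a p) q &
    polygonal_length a g q = polygonal_length a g p.
Proof.
elim: p a => [|t p IH] a /=; first by exists [::].
case/andP => + /IH[q [qs /eqP ql] qE]; rewrite le_eqVlt => /predU1P[at_|lt_at].
  by subst t; exists q; rewrite ?polygonal_length_cons ?mdistxx ?add0r//;
    split=> //; apply/eqP.
exists (t :: q); first by split; rewrite /= ?lt_at ?ql.
by rewrite !polygonal_length_cons qE.
Qed.

Lemma polygonal_le_curve_length a b g p : path <=%R a p -> last a p = b ->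
  ((polygonal_length a g p)%:E <= curve_length a b g)%E.
Proof.
move=> /(polygonal_length_strict g)[q + <-] <- => qp.
by apply: ereal_sup_ubound; exists q.
Qed.

Lemma curve_length_le a b g (l : \bar R) :
  (forall p, path <=%R a p -> last a p = b ->
     ((polygonal_length a g p)%:E <= l)%E) ->
  (curve_length a b g <= l)%E.
Proof.
move=> H; apply: ge_ereal_sup => _ [p [ps /eqP pl] <-]; apply: H => //.
by apply: sub_path ps => s t /ltW.
Qed.

Lemma mdist_le_curve_length a b g s t : a <= s -> s <= t -> t <= b ->
  ((mdist (g s) (g t))%:E <= curve_length a b g)%E.
Proof.
move=> as_ st tb.
apply: le_trans (polygonal_le_curve_length (p := [:: s; t; b]) _ _ _).
- rewrite !polygonal_length_cons polygonal_length_nil lee_fin.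
  rewrite (metric_sym (g s) (g t)) addr0.
  have := mdist_ge0 (g s) (g a); have := mdist_ge0 (g b) (g t); lra.
- by rewrite /= as_ st tb.
- by [].
Qed.

Lemma curve_length_ge0 a b g : a <= b -> (0 <= curve_length a b g)%E.
Proof.
by move=> ab; have := mdist_le_curve_length g (lexx a) (lexx a) ab;
  rewrite mdistxx.
Qed.

Lemma curve_lengthxx a g : curve_length a a g = 0%E.
Proof.
apply/eqP; rewrite eq_le curve_length_ge0// andbT.
apply: ge_ereal_sup => _ [p /itv_partitionxx -> <-].
by rewrite polygonal_length_nil.
Qed.

Lemma curve_length_subr a t b g : t <= b ->
  (curve_length a t g <= curve_length a b g)%E.
Proof.
move=> tb; apply: curve_length_le => p ap pl.
apply: le_trans (polygonal_le_curve_length (p := rcons p b) _ _ _).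
- by rewrite polygonal_length_rcons lee_fin lerDl mdist_ge0.
- by rewrite rcons_path ap pl.
- by rewrite last_rcons.
Qed.

(** Inserting [b] into a partition of [a, c] does not shorten it, by the triangle inequality, and
    splits it into two partitions. *)
Lemma curve_length_cat a b c g : a <= b -> b <= c ->
  (curve_length a c g <= curve_length a b g + curve_length b c g)%E.
Proof.
move=> ab bc; apply: curve_length_le => p ap pl.
have : b <= last a p by rewrite pl.
suff: b <= last a p -> exists p1 p2, [/\ path <=%R a p1 /\ last a p1 = b,
    path <=%R b p2 /\ last b p2 = last a p &
    polygonal_length a g p <=
      polygonal_length a g p1 + polygonal_length b g p2].
  move=> /[apply] -[p1 [p2 [[ap1 l1] [ap2 l2] le12]]].
  rewrite pl in l2.
  apply: (le_trans _ (leeD (polygonal_le_curve_length g ap1 l1)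
    (polygonal_le_curve_length g ap2 l2))).
  by rewrite -EFinD lee_fin.
elim: p a ab ap {pl} => [|t p IH] a ab /=.
  move=> _ ba; have -> : b = a by apply/eqP; rewrite eq_le ba.
  by exists [::], [::]; split => //=; rewrite polygonal_length_nil addr0.
case/andP => at_ tp bl; case: (leP t b) => tb.
  have [p1 [p2 [[ap1 l1] [ap2 l2] le12]]] := IH t tb tp bl.
  exists (t :: p1), p2; split => //=; first by rewrite at_.
  by rewrite !polygonal_length_cons -addrA lerD2l.
exists [:: b], (t :: p); split => //=; first by rewrite ab.
  by rewrite (ltW tb).
rewrite !polygonal_length_cons polygonal_length_nil.
have := metric_triangle (g t) (g b) (g a); lra.
Qed.

(** A monotone [f] keeps sequences weakly increasing. As [h] is prescribed on [a, b] only, the case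
    [f = id] also compares two functions with the same restriction. *)
Lemma curve_length_reparam a b g h (f : R -> R) :
  {in `[a, b] &, {homo f : s t / s <= t}} ->
  {in `[a, b], forall t, h t = g (f t)} ->
  (curve_length a b h <= curve_length (f a) (f b) g)%E.
Proof.
move=> fh hE; apply: curve_length_le => p ap pl.
suff [fp fl ->] : [/\ path <=%R (f a) (map f p), last (f a) (map f p) = f b &
    polygonal_length a h p = polygonal_length (f a) g (map f p)].
  exact: polygonal_le_curve_length.
elim: p a fh hE ap pl => [|t p IH] a fh hE /=.
  by move=> _ ->; rewrite !polygonal_length_nil.
case/andP => at_ tp tb.
have tlb : t <= b.
  by rewrite -tb; elim: p t tp {IH tb at_} => //= s p IH t /andP[ts /IH];
    exact: le_trans.
have ata : t \in `[a, b] by rewrite in_itv/= at_.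
have aa : a \in `[a, b] by rewrite in_itv/= lexx (le_trans at_).
have sub : {subset `[t, b] <= `[a, b]}.
  by move=> s; rewrite !in_itv/= => /andP[/(le_trans at_)-> ->].
have [||-> -> fE] := IH t _ _ tp tb.
- by move=> s s' /sub si /sub s'i; exact: fh.
- by move=> s /sub; exact: hE.
- by split=> //; rewrite ?fh// !polygonal_length_cons fE !hE.
Qed.

(** An order-reversing [f] makes the sequence run backwards, so each point put in front of [p] is
    matched by one appended to [q]. *)
Lemma curve_length_rev a b g h (f : R -> R) :
  {in `[a, b] &, {homo f : s t /~ s <= t}} ->
  {in `[a, b], forall t, h t = g (f t)} ->
  (curve_length a b h <= curve_length (f b) (f a) g)%E.
Proof.
move=> fh hE; apply: curve_length_le => p ap pl.
suff [q [fp fl ->]] : exists q, [/\ path <=%R (f b) q, last (f b) q = f a &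
    polygonal_length a h p = polygonal_length (f b) g q].
  exact: polygonal_le_curve_length.
elim: p a fh hE ap pl => [|t p IH] a fh hE /=.
  by move=> _ <-; exists [::]; rewrite !polygonal_length_nil.
case/andP => at_ tp tb.
have tlb : t <= b.
  by rewrite -tb; elim: p t tp {IH tb at_} => //= s p IH t /andP[ts /IH];
    exact: le_trans.
have ata : t \in `[a, b] by rewrite in_itv/= at_.
have aa : a \in `[a, b] by rewrite in_itv/= lexx (le_trans at_).
have sub : {subset `[t, b] <= `[a, b]}.
  by move=> s; rewrite !in_itv/= => /andP[/(le_trans at_)-> ->].
have [||q [qp ql qE]] := IH t _ _ tp tb.
- by move=> s s' /sub si /sub s'i; exact: fh.
- by move=> s /sub; exact: hE.
exists (rcons q (f a)); rewrite last_rcons rcons_path qp ql fh//; split => //.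
rewrite polygonal_length_cons polygonal_length_rcons qE ql !hE//.
by rewrite addrC metric_sym.
Qed.

End CurveLength.

(** * First hitting times, concatenation of curves, and carrots *)

Section Curves.
Context {R : realType} {X : metricType R}.
Implicit Types (a b c t C L : R) (g h : R -> X) (u v w x y : X) (G P : set X).

Lemma within_itv_continuousP a b g :
  {within `[a, b], continuous g} <->
  forall t, t \in `[a, b] -> forall e, 0 < e -> exists2 d, 0 < d &
    forall s, s \in `[a, b] -> `|t - s| < d -> mdist (g t) (g s) < e.
Proof.
split=> [/subspace_continuousP cg t tab e e0|H].
  have /cvg_ballP/(_ e e0) := cg t tab.
  rewrite near_withinE => /nbhs_ballP[d /= d0 dP].
  exists d => // s sab tsd; have := dP s tsd sab.
  by rewrite ballEmdist.
apply/subspace_continuousP => t tab; apply/cvg_ballP => e e0.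
have [d d0 dP] := H t tab e e0.
rewrite near_withinE; apply/nbhs_ballP; exists d => //= s tsd sab.
by rewrite ballEmdist; exact: dP.
Qed.

(** The time is the infimum of those at which the distance is at least [r]. Before it the distance
    is below [r], and continuity gives equality there. *)
Lemma first_hitting a b g x r : is_curve a b g ->
  mdist x (g a) <= r <= mdist x (g b) ->
  exists2 t, t \in `[a, b] &
    mdist x (g t) = r /\ {in `[a, t], forall s, mdist x (g s) <= r}.
Proof.
move=> [ab /within_itv_continuousP cg] /andP[ar rb].
pose A := [set t | t \in `[a, b] /\ r <= mdist x (g t)].
have Ab : A b by split=> //; rewrite in_itv/= ab lexx.
have lA : lbound A a by move=> t [+ _]; rewrite in_itv/= => /andP[].
have hA : has_inf A by split; [exists b|exists a].
have infb : inf A <= b by apply: ge_inf => //; exists a.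
have infa : a <= inf A by apply: lb_le_inf => //; exists b.
have infab : inf A \in `[a, b] by rewrite in_itv/= infa.
have below s : a <= s -> s < inf A -> mdist x (g s) < r.
  move=> as_ si; rewrite ltNge; apply/negP => rs.
  move: (si); rewrite ltNge => /negP; apply; apply: ge_inf; first by exists a.
  by split => //; rewrite in_itv/= as_ (le_trans (ltW si)).
have gE : mdist x (g (inf A)) = r.
  apply/eqP; rewrite eq_le; apply/andP; split; rewrite leNgt;
    apply/negP => lt_r.
    have /(cg _ infab)[d d0 dP] : 0 < mdist x (g (inf A)) - r.
      by rewrite subr_gt0.
    have ai : a < inf A.
      rewrite lt_neqAle infa andbT; apply/eqP => aE.
      by move: lt_r; rewrite -aE ltNge ar.
    (* A time of [a, inf A) so close to [inf A] that the distance would still exceed [r]. *)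
    pose s := Num.max a (inf A - d / 2).
    have sa : a <= s by rewrite le_max lexx.
    have si : s < inf A by rewrite gt_max ai; lra.
    have sd : inf A - d / 2 <= s by rewrite le_max lexx orbT.
    have := dP s; rewrite in_itv/= sa (le_trans (ltW si) infb) => /(_ isT).
    rewrite ger0_norm; last by lra.
    have := below s sa si; have := metric_triangle x (g s) (g (inf A)).
    by rewrite (metric_sym (g s)); lra.
  have /(cg _ infab)[d d0 dP] : 0 < r - mdist x (g (inf A)) by rewrite subr_gt0.
  have [s [sab rs] sd] := inf_adherent d0 hA.
  have is_ : inf A <= s by apply: ge_inf; [exists a|].
  have := dP s sab; rewrite ler0_norm; last by lra.
  have := metric_triangle x (g (inf A)) (g s); lra.
exists (inf A) => //; split=> // s; rewrite in_itv/= => /andP[as_].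
rewrite le_eqVlt => /predU1P[->|/below]; first by rewrite gE.
by move=> /(_ as_)/ltW.
Qed.

Lemma is_curve_rev a b g : is_curve a b g -> is_curve (- b) (- a) (g \o -%R).
Proof.
move=> [ab /within_itv_continuousP cg]; split; first by rewrite lerN2.
apply/within_itv_continuousP => t tab e e0.
have oppi s : s \in `[- b, - a] -> - s \in `[a, b].
  by rewrite !in_itv/= lerNl lerNr andbC.
have [d d0 dP] := cg _ (oppi _ tab) _ e0; exists d => // s /oppi sab ts.
by apply: dP => //; rewrite -opprD normrN.
Qed.

(** [h] is shifted in time to start at [b]. The glued function is continuous because it is so on two
    closed intervals with union [a, c]. *)
Lemma curve_concat a b g a' b' h :
  is_curve a b g -> is_curve a' b' h -> g b = h a' ->
  exists k, let c := b + (b' - a') in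
    [/\ is_curve a c k, {in `[a, b], k =1 g} &
        {in `[b, c], forall t, k t = h (t - b + a')}].
Proof.
move=> [ab cg] [ab' ch] gh.
exists (fun t => if t <= b then g t else h (t - b + a')) => c.
have bc : b <= c by rewrite /c; lra.
have kg : {in `[a, b], (fun t => if t <= b then g t else h (t - b + a')) =1 g}.
  by move=> t; rewrite in_itv/= => /andP[_ ->].
have kh : {in `[b, c], forall t,
    (if t <= b then g t else h (t - b + a')) = h (t - b + a')}.
  move=> t; rewrite in_itv/= => /andP[bt _]; case: ifPn => // tb.
  by have -> : t = b by [apply/eqP; rewrite eq_le tb]; rewrite gh subrr add0r.
split => //; split; first exact: le_trans bc.
have -> : `[a, c]%classic = `[a, b] `|` `[b, c].
  apply/seteqP; split => t /=; rewrite !in_itv/=.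
    by move=> /andP[-> ->]; rewrite andbT; case: (leP t b) => [|/ltW];
      [left|right].
  move=> [/andP[-> /le_trans->//]|/andP[bt ->]].
  by rewrite (le_trans ab bt).
apply: withinU_continuous; [exact: itv_closed|exact: itv_closed| |].
  by apply: subspace_eq_continuous cg => t; rewrite inE => tab; exact/esym/kg.
apply/within_itv_continuousP => t tbc e e0.
have shift s : s \in `[b, c] -> s - b + a' \in `[a', b'].
  by rewrite !in_itv/= /c; lra.
move/within_itv_continuousP : ch => /(_ _ (shift _ tbc) _ e0)[d d0 dP].
exists d => // s sbc tsd; rewrite !kh//; apply: dP; first exact: shift.
by rewrite (_ : _ - _ = t - s)//; lra.
Qed.

(** The real bound [L] on the length makes the curve rectifiable. *)
Definition linked P L u v := exists a b g,
  [/\ is_curve a b g, joins u v a b g, (curve_length a b g <= L%:E)%E &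
      trace a b g `<=` P].

Lemma linked_sub P P' L L' u v : P `<=` P' -> L <= L' ->
  linked P L u v -> linked P' L' u v.
Proof.
move=> PP' LL' [a [b [g [cg j len tr]]]]; exists a, b, g; split => //.
  by apply: le_trans len _; rewrite lee_fin.
exact: subset_trans tr PP'.
Qed.

Lemma is_curve_cst u : is_curve 0 0 (cst u : R -> X).
Proof. by split=> //; apply: continuous_subspaceT; exact: cst_continuous. Qed.

Lemma linked_refl P u : P u -> linked P 0 u u.
Proof.
move=> Pu; exists 0, 0, (cst u); split=> //; first exact: is_curve_cst.
  by rewrite curve_lengthxx.
by move=> _ [t _ <-].
Qed.

Lemma linked_trans P L L' u v w :
  linked P L u v -> linked P L' v w -> linked P (L + L') u w.
Proof.
move=> [a [b [g [cg [ga gb] lg trg]]]] [a' [b' [h [ch [ha hb] lh trh]]]].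
have [|k [ck kg kh]] := curve_concat cg ch; first by rewrite gb ha.
have [ab ab'] := (cg.1, ch.1).
set c := b + (b' - a') in ck kg kh *.
have bc : b <= c by rewrite /c; lra.
have shift t : t \in `[b, c] -> t - b + a' \in `[a', b'].
  by rewrite !in_itv/= /c; lra.
exists a, c, k; split=> //.
- split; first by rewrite kg ?in_itv/= ?lexx.
  by rewrite kh ?in_itv/= ?bc ?lexx// (_ : _ + _ = b')//; rewrite /c; lra.
- apply: (le_trans (curve_length_cat k ab bc)); rewrite EFinD leeD//.
    exact: le_trans (curve_length_reparam (f := id) _ kg) lg.
  have := @curve_length_reparam _ _ b c h k (fun t => t - b + a').
  rewrite subrr add0r (_ : _ + _ = b'); last by rewrite /c; lra.
  by move=> /(_ _ kh)/le_trans; apply => // s t _ _ st; lra.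
- move=> _ [t /= + <-]; rewrite in_itv/= => /andP[at_ tc].
  case: (leP t b) => [tb|/ltW bt].
    by rewrite kg ?in_itv/= ?at_//; apply: trg; exists t;
      rewrite //= in_itv/= at_.
  have tbc : t \in `[b, c] by rewrite in_itv/= bt.
  by rewrite kh//; apply: trh; exists (t - b + a') => //; exact: shift.
Qed.

(** A curve from [u] of length below [s] cannot leave the ball of radius [s]. *)
Lemma length_space_linked u v s : length_space X -> mdist u v < s ->
  linked (ball u s) s u v.
Proof.
move=> /(_ u v)[_ duv] uvs.
have : ((mdist u v)%:E < s%:E)%E by rewrite lte_fin.
rewrite duv => /ereal_inf_lt[_ [a [b [g [[cg _ [ga gb]] ->]]]] lt_s].
exists a, b, g; split=> //; first exact: ltW.
move=> _ [t /= + <-]; rewrite in_itv/= => /andP[at_ tb].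
rewrite ballEmdist/= -lte_fin -ga; apply: le_lt_trans lt_s.
exact: mdist_le_curve_length.
Qed.

(** Membership in [G] is required separately: where the covered length is zero, as at [x], the bound
    on it says nothing. *)
Definition carrot G C L x v := exists a b g,
  [/\ is_curve a b g, joins x v a b g, (curve_length a b g <= L%:E)%E &
      {in `[a, b], forall t,
        G (g t) /\ (curve_length a t g <= (C * bdist G (g t))%:E)%E}].

Lemma bdist_ge0 G x : 0 <= bdist G x.
Proof.
rewrite /bdist; case: (pselect ([set mdist x y | y in ~` G] !=set0)) => [ne|].
  by apply: lb_le_inf => // _ [y _ <-]; exact: mdist_ge0.
(* The complement of [G] is empty here, and [inf] takes its default value 0. *)
by move/set0P/negP/negPn/eqP => ->; rewrite inf0.
Qed.

Lemma carrot_le G C C' L L' x v : C <= C' -> L <= L' ->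
  carrot G C L x v -> carrot G C' L' x v.
Proof.
move=> CC' LL' [a [b [g [cg j len tr]]]]; exists a, b, g; split => //.
  by apply: le_trans len _; rewrite lee_fin.
move=> t /tr[Gt le_t]; split=> //; apply: le_trans le_t _.
by rewrite lee_fin ler_wpM2r// bdist_ge0.
Qed.

Lemma carrot_refl G C x : 0 <= C -> G x -> carrot G C 0 x x.
Proof.
move=> C0 Gx; exists 0, 0, (cst x); split=> //; first exact: is_curve_cst.
  by rewrite curve_lengthxx.
move=> t; rewrite in_itv/= => t0; have -> : t = 0 by apply/le_anti;
  rewrite andbC.
by rewrite curve_lengthxx lee_fin mulr_ge0// bdist_ge0.
Qed.

(** On the added piece the length covered is at most the total [L + L'], so it is enough that
    [C * bdist] exceeds this total there. *)
Lemma carrot_extend G C L L' x v w : carrot G C L x v ->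
  linked [set z | G z /\ L + L' <= C * bdist G z] L' v w ->
  carrot G C (L + L') x w.
Proof.
move=> [a [b [g [cg [ga gb] lg trg]]]] [a' [b' [h [ch [ha hb] lh trh]]]].
have [|k [ck kg kh]] := curve_concat cg ch; first by rewrite gb ha.
have [ab ab'] := (cg.1, ch.1).
set c := b + (b' - a') in ck kg kh *.
have bc : b <= c by rewrite /c; lra.
have shift t : t \in `[b, c] -> t - b + a' \in `[a', b'].
  by rewrite !in_itv/= /c; lra.
have kgl t : t \in `[a, b] -> (curve_length a t k <= curve_length a t g)%E.
  move=> tab; apply: (curve_length_reparam (f := id)) => // s.
  move: tab; rewrite in_itv/= => /andP[_ tb] sat; apply: kg.
  by move: sat; rewrite !in_itv/= => /andP[-> /le_trans->].
have len : (curve_length a c k <= (L + L')%:E)%E.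
  apply: (le_trans (curve_length_cat k ab bc)); rewrite EFinD leeD//.
    by apply: le_trans (kgl _ _) lg; rewrite in_itv/= lexx ab.
  have := @curve_length_reparam _ _ b c h k (fun t => t - b + a').
  rewrite subrr add0r (_ : _ + _ = b'); last by rewrite /c; lra.
  by move=> /(_ _ kh)/le_trans; apply => // s t _ _ st; lra.
exists a, c, k; split=> //.
  split; first by rewrite kg ?in_itv/= ?lexx.
  by rewrite kh ?in_itv/= ?bc ?lexx// (_ : _ + _ = b')//; rewrite /c; lra.
move=> t; rewrite in_itv/= => /andP[at_ tc]; case: (leP t b) => [tb|/ltW bt].
  have tab : t \in `[a, b] by rewrite in_itv/= at_.
  by have [Gt ltd] := trg t tab; rewrite kg//; split=> //;
    exact: le_trans (kgl t tab) ltd.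
have tbc : t \in `[b, c] by rewrite in_itv/= bt.
rewrite kh//; have [|Gt lt] := trh (h (t - b + a')).
  by exists (t - b + a') => //; exact: shift.
split=> //; apply: le_trans (curve_length_subr a k tc) (le_trans len _).
by rewrite lee_fin.
Qed.

(** The second carrot is run backwards. On the first half the length from [x] is controlled, on the
    second the length to [y]; either one bounds the minimum. *)
Lemma carrot_join G C L L' x y v : carrot G C L x v -> carrot G C L' y v ->
  exists a b g, [/\ rectifiable_curve_joining_in G x y a b g,
    (curve_length a b g <= (L + L')%:E)%E &
    forall t, t \in `[a, b] ->
      (Order.min (curve_length a t g) (curve_length t b g)
        <= (C * bdist G (g t))%:E)%E].
Proof.
move=> [a [b [g [cg [ga gb] lg trg]]]].
move=> [b' [a' [h' [/is_curve_rev ch [ha hb] lh' trh]]]].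
pose h := h' \o -%R.
have [|k [ck kg kh]] := curve_concat cg ch; first by rewrite gb -hb /= opprK.
have [ab ab'] := (cg.1, ch.1).
set c := b + (- b' - - a') in ck kg kh *.
have bc : b <= c by rewrite /c; lra.
have shift t : t \in `[b, c] -> - (t - b - a') \in `[b', a'].
  by rewrite !in_itv/= /c; lra.
have kgl t : t \in `[a, b] -> (curve_length a t k <= curve_length a t g)%E.
  move=> tab; apply: (curve_length_reparam (f := id)) => // s.
  move: tab; rewrite in_itv/= => /andP[_ tb] sat; apply: kg.
  by move: sat; rewrite !in_itv/= => /andP[-> /le_trans->].
have khl t : t \in `[b, c] ->
    (curve_length t c k <= curve_length b' (- (t - b - a')) h')%E.
  move=> tbc; have := @curve_length_rev _ _ t c h' k (fun s => - (s - b - a')).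
  rewrite (_ : - (c - _ - _) = b'); last by rewrite /c; lra.
  apply=> [s s' _ _ ss'|s sc]; first by lra.
  by apply: kh; move: tbc sc; rewrite !in_itv/=; lra.
have len : (curve_length a c k <= (L + L')%:E)%E.
  apply: (le_trans (curve_length_cat k ab bc)); rewrite EFinD leeD//.
    by apply: le_trans (kgl _ _) lg; rewrite in_itv/= lexx ab.
  apply: le_trans (khl b _) _; first by rewrite in_itv/= lexx bc.
  by rewrite (_ : - _ = a')//; lra.
have kG t : t \in `[a, c] -> G (k t) /\
    (Order.min (curve_length a t k) (curve_length t c k)
      <= (C * bdist G (k t))%:E)%E.
  rewrite in_itv/= => /andP[at_ tc]; case: (leP t b) => [tb|/ltW bt].
    have tab : t \in `[a, b] by rewrite in_itv/= at_.
    have [Gt ltd] := trg t tab; rewrite kg//; split=> //.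
    by rewrite ge_min (le_trans (kgl t tab) ltd).
  have tbc : t \in `[b, c] by rewrite in_itv/= bt.
  have [Gt ltd] := trh _ (shift t tbc); rewrite kh//; split=> //.
  by rewrite ge_min (le_trans (khl t tbc) ltd) orbT.
exists a, c, k; split=> //; last by move=> t /kG[].
split; last by move=> _ [t /= /kG[Gt _] <-].
split=> //; first by apply: le_lt_trans len _; rewrite ltry.
split; first by rewrite kg ?in_itv/= ?lexx.
by rewrite kh ?in_itv/= ?bc ?lexx//= -ha; congr h'; rewrite /c; lra.
Qed.

End Curves.

(** * Chains in doubling spaces *)

Section Chains.
Context {R : realType} {X : metricType R}.
Implicit Types (s r Q : R) (u v w x y z : X) (E P : set X) (l : seq X).

Lemma doubling_size Q x r l : doubling Q X -> 0 < r -> uniq l ->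
  [set` l] `<=` ball x r -> Defs.separated (r / 2) [set` l] -> (size l)%:R <= Q.
Proof.
move=> dQ r0 ul lx ls; have [n ln nQ] := dQ x r r0 _ lx ls.
apply: le_trans nQ; rewrite ler_nat -(card_fset_set ln).
by apply: uniq_leq_size => // z zl; rewrite in_fset_set ?inE//;
  apply/finite_setP; exists n.
Qed.

(** Greedy choice: a point is dropped when a kept one lies within [s]. The alternative [v = u]
    matters when [s] is not positive. *)
Lemma separated_net s l : exists l',
  [/\ uniq l', {subset l' <= l}, Defs.separated s [set` l'] &
      forall u, u \in l -> exists2 v, v \in l' & mdist v u < s \/ v = u].
Proof.
elim: l => [|u l [l' [ul' sl' sep cov]]]; first by exists [::]; split=> // u v.
have [[v vl' vu]|far] := pselect (exists2 v, v \in l' & mdist v u < s).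
  exists l'; split=> //; first by move=> w /sl'; rewrite inE orbC => ->.
  by move=> w /[1!inE] /predU1P[->|/cov//]; exists v => //; left.
have far' v : v \in l' -> s <= mdist v u.
  by move=> vl'; rewrite leNgt; apply/negP => vu; apply: far; exists v.
have [ul|nul] := boolP (u \in l').
  exists l'; split=> //; first by move=> w /sl'; rewrite inE orbC => ->.
  by move=> w /[1!inE] /predU1P[->|/cov//]; exists u => //; right.
exists (u :: l'); split.
- by rewrite /= nul.
- by move=> w; rewrite !inE => /orP[->//|/sl'->]; rewrite orbT.
- move=> v w /= /[!inE] /predU1P[->|vl'] /predU1P[->|wl'] vw //.
  + by rewrite metric_sym; exact: far'.
  + exact: far'.
  + exact: sep.
- move=> w /[1!inE] /predU1P[->|/cov[v vl' vw]].
    by exists u; rewrite ?inE ?eqxx//; right.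
  by exists v; rewrite // inE vl' orbT.
Qed.

(** Induction on the number of halvings: a net at half the radius has at most [Q] points, and the
    induction hypothesis bounds the part of [l] near each of them. *)
Lemma doubling_size_exp Q m x s l : doubling Q X -> 0 < s -> uniq l ->
  [set` l] `<=` ball x (2 ^+ m * s) -> Defs.separated s [set` l] ->
  (size l)%:R <= Q ^+ m.+1.
Proof.
(* The empty family shows that [Q] is nonnegative. *)
move=> dQ s0; have Q0 : 0 <= Q.
  rewrite -[0](_ : (size ([::] : seq X))%:R = 0)//.
  by apply: (@doubling_size Q x s [::]) => //.
elim: m x l => [|m IH] x l ul lx ls.
  rewrite expr0 mul1r in lx; rewrite expr1; apply: (doubling_size dQ s0 ul lx).
  by move=> u v ul' vl uv; have := ls u v ul' vl uv; lra.
have r0 : 0 < 2 ^+ m.+1 * s by rewrite mulr_gt0// exprn_gt0.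
have [l' [ul' sl' sep cov]] := separated_net (2 ^+ m.+1 * s / 2) l.
have sl'Q : (size l')%:R <= Q.
  by apply: (@doubling_size Q x _ l' dQ r0 ul' _ sep) => u /= /sl' /lx.
have rE : 2 ^+ m.+1 * s / 2 = 2 ^+ m * s by rewrite exprS; lra.
have r'0 : 0 < 2 ^+ m * s by rewrite mulr_gt0// exprn_gt0.
pose near v u := mdist v u < 2 ^+ m * s.
(* Double counting: every point of [l] is near at least one point of the net. *)
have lel : (size l <= \sum_(v <- l') count (near v) l)%N.
  under eq_bigr do rewrite -sum1_count.
  rewrite (exchange_big_dep predT)//= -sum1_size big_seq [leqRHS]big_seq.
  apply: leq_sum => u /cov[v vl' vu].
  rewrite sum1_count -has_count; apply/hasP; exists v => //.
  by case: vu => [|->]; rewrite /near ?mdistxx// rE.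
apply: le_trans (_ : \sum_(v <- l') Q ^+ m.+1 <= _); last first.
  rewrite big_const_seq count_predT iter_addr_0 -mulr_natl [leRHS]exprS.
  by rewrite ler_wpM2r// exprn_ge0.
apply: (@le_trans _ _ (\sum_(v <- l') count (near v) l)%:R).
  by rewrite ler_nat.
rewrite natr_sum; apply: ler_sum => v _; rewrite -size_filter.
apply: (IH v).
- exact: filter_uniq.
- by move=> u /=; rewrite mem_filter ballEmdist => /andP[].
- by move=> u w /=; rewrite !mem_filter => /andP[_ ?] /andP[_ ?]; exact: ls.
Qed.

(** Chains of [n] steps shorter than [s]. Every point but the first is required to lie in [E]; [E u]
    is a separate hypothesis where it is needed. *)
Fixpoint reaches E s u n v : Prop :=
  if n is n'.+1 then E v /\ exists2 w, reaches E s u n' w & mdist w v < s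
  else v = u.

Lemma reaches_in E s u n v : E u -> reaches E s u n v -> E v.
Proof. by case: n => [|n] Eu /= => [->|[]]. Qed.

(** The set of reached points is open and closed in [E], since a point of [E] within [s] of a
    reached point is reached too. *)
Lemma connected_reaches E s u v : connected E -> 0 < s -> E u -> E v ->
  exists n, reaches E s u n v.
Proof.
move=> cE s0 Eu Ev; pose B := [set z | exists n, reaches E s u n z].
have BE z : B z -> E z by move=> [n]; exact: reaches_in.
have Bs z w : B z -> E w -> mdist z w < s -> B w.
  by move=> [n rz] Ew zw; exists n.+1; split=> //; exists z.
suff : B = E by move=> BE'; rewrite -BE' in Ev.
apply: cE; first by exists u, 0%N.
- exists (\bigcup_(z in B) (ball z s)°).
    by apply: bigcup_open => z _; exact: open_interior.
  apply/seteqP; split=> [z Bz|z [Ez [w Bw /interior_subset]]].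
    by split; [exact: BE|exists z => //; apply: nbhsx_ballx].
  by rewrite ballEmdist => /(Bs w z Bw Ez).
- exists (~` \bigcup_(z in E `\` B) (ball z s)°).
    by apply: open_closedC; apply: bigcup_open => z _; exact: open_interior.
  apply/seteqP; split=> [z Bz|z [Ez nz]].
    split; first exact: BE.
    move=> [w [Ew nBw] /interior_subset]; rewrite ballEmdist /= metric_sym.
    by move=> /(Bs z w Bz Ew).
  apply: contrapT => nBz; apply: nz; exists z => //; apply: nbhsx_ballx.
  exact: s0.
Qed.

Lemma reaches_linked E P s u n v : length_space X -> E u ->
  (forall z, E z -> ball z s `<=` P) -> 0 < s ->
  reaches E s u n v -> linked P (n%:R * s) u v.
Proof.
move=> lX Eu EP s0; elim: n v => [|n IH] v /=.
  move=> ->; rewrite mul0r; apply: linked_refl; apply: (EP u Eu).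
  exact: ballxx.
move=> [Ev [w rw wv]]; rewrite mulrSr mulrDl mul1r.
apply: linked_trans (IH _ rw) _;
  apply: linked_sub (length_space_linked lX wv) => //.
exact/EP/(reaches_in Eu rw).
Qed.

(** Every other point of a shortest chain is taken, going back from [v]. Two of these closer than
    [s] would allow a shortcut. *)
Lemma shortest_chain_separated E s u n v : 0 < s -> E u ->
  reaches E s u n v -> (forall k, (k < n)%N -> ~ reaches E s u k v) ->
  exists l, [/\ size l = n./2.+1, uniq l, [set` l] `<=` E &
    Defs.separated s [set` l]].
Proof.
move=> s0 Eu.
(* The induction also records that the chosen points are reached in at most [n] steps, so that one
   of them near the end of a chain two steps longer would shorten it. *)
suff H : reaches E s u n v -> (forall k, (k < n)%N -> ~ reaches E s u k v) ->
  exists l, [/\ size l = n./2.+1, uniq l, Defs.separated s [set` l] &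
    forall w, w \in l -> exists2 k, (k <= n)%N & reaches E s u k w].
  move=> rv nv; have [l [sl ul sep ll]] := H rv nv; exists l;
    split => // w /ll[k _].
  exact: reaches_in.
have [N] := ubnP n; elim: N n v => // N IH [|[|n]] v nN rv nv.
- exists [:: v]; split=> //; last by move=> w /[1!inE] /eqP->; exists 0%N.
  by move=> a b /= /[!inE] /eqP-> /eqP->.
- exists [:: v]; split=> //; last by move=> w /[1!inE] /eqP->; exists 1%N.
  by move=> a b /= /[!inE] /eqP-> /eqP->.
have [Ev [w [Ew [w' rw' w'w]] wv]] := rv.
have nw' k : (k < n)%N -> ~ reaches E s u k w'.
  move=> kn rk; apply: (nv k.+2) => //=; split=> //; exists w => //; split=> //.
  by exists w'.
have [|l [sl ul sep ll]] := IH n w' _ rw' nw'; first by rewrite -ltnS ltnW.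
have far z : z \in l -> s <= mdist z v.
  move=> /ll[k kn rk]; rewrite leNgt; apply/negP => zv.
  by apply: (nv k.+1) => //=; split=> //; exists z.
exists (v :: l); split.
- by rewrite /= sl.
- rewrite /= ul andbT; apply/negP => /far; rewrite mdistxx; lra.
- move=> a b /= /[!inE] /predU1P[->|al] /predU1P[->|bl] ab //.
  + by rewrite metric_sym; exact: far.
  + exact: far.
  + exact: sep.
- move=> z /[1!inE] /predU1P[->|/ll[k kn rk]]; first by exists n.+2.
  by exists k => //; rewrite (leq_trans kn)// leqW.
Qed.

Lemma connected_linked Q m s E P u v x : doubling Q X -> length_space X ->
  connected E -> E u -> E v -> E `<=` ball x (2 ^+ m * s) -> 0 < s ->
  (forall z, E z -> ball z s `<=` P) -> linked P (2 * Q ^+ m.+1 * s) u v.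
Proof.
move=> dQ lX cE Eu Ev Ex s0 EP.
have exn : exists n, `[< reaches E s u n v >].
  by have [n rn] := connected_reaches cE s0 Eu Ev; exists n; apply/asboolP.
case: (ex_minnP exn) => n /asboolP rn minn.
have [k kn /asboolP/minn|l [sl ul lE sep]] := shortest_chain_separated s0 Eu rn.
  by rewrite leqNgt kn.
have := doubling_size_exp dQ s0 ul (subset_trans lE Ex) sep.
rewrite sl => nQ; apply: linked_sub (reaches_linked lX Eu EP s0 rn) => //.
(* The separated family has [n./2.+1] points, and [n] is at most twice this number. *)
rewrite ler_pM2r//; apply: (@le_trans _ _ (2 * n./2.+1%:R));
  last by rewrite ler_pM2l.
by rewrite -natrM ler_nat mul2n doubleS leqW// -leq_half_double.
Qed.

End Chains.

(** * Carrots *)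

Section BoundaryDistance.
Context {R : realType} {X : metricType R} (G : set X).
Implicit Types (x y z : X).

Lemma bdist_le x z : ~ G z -> bdist G x <= mdist x z.
Proof.
move=> nGz; apply: ge_inf; last by exists z.
by exists 0 => _ [w _ <-]; exact: mdist_ge0.
Qed.

Lemma bdist_gt0_in x : 0 < bdist G x -> G x.
Proof.
move=> x0; apply: contrapT => /(@bdist_le x); rewrite mdistxx; lra.
Qed.

Hypothesis G_proper : G `<` [set: X].

Let complement_nonempty : exists z, ~ G z.
Proof.
case: G_proper => _ nG; apply: contrapT => /forallNP H.
by apply: nG => z _; apply: contrapT; exact: H.
Qed.

Lemma bdist_lipschitz x y : bdist G x <= bdist G y + mdist x y.
Proof.
rewrite -lerBlDr; apply: lb_le_inf.
  by have [z nGz] := complement_nonempty; exists (mdist y z), z.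
move=> _ [z nGz <-]; rewrite lerBlDr addrC.
exact: le_trans (bdist_le x nGz) (metric_triangle _ _ _).
Qed.

Lemma bdist_gt0 x : open G -> G x -> 0 < bdist G x.
Proof.
move=> oG Gx; have /nbhs_ballP[e /= e0 eG] : nbhs x G by apply: open_nbhs_nbhs.
apply: lt_le_trans e0 _; apply: lb_le_inf.
  by have [z nGz] := complement_nonempty; exists (mdist x z), z.
move=> _ [z nGz <-]; rewrite leNgt; apply/negP => xz; apply/nGz/eG.
by rewrite ballEmdist.
Qed.

End BoundaryDistance.

(** * Construction of carrots at dyadic scales *)

Section Domain.
Context {R : realType} {X : metricType R} (Q : R) (G : set X).
Hypotheses (Q_ge0 : 0 <= Q) (X_doubling : doubling Q X).
Hypothesis X_length : length_space X.
Hypotheses (G_open : open G) (G_proper : G `<` [set: X]).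
Implicit Types (r c : R) (u v w x y z : X) (E : set X).

Lemma bounded_turning_linked c : 0 < c -> exists2 M, 1 <= M &
  forall E u v x r, 0 < r -> connected E -> E u -> E v ->
    (forall z, E z -> mdist x z <= c * r) ->
    (forall z, E z -> r <= c * bdist G z) ->
    linked [set z | G z /\ r <= M * bdist G z] (M * r) u v.
Proof.
move=> c0.
(* This makes [2 ^+ m * s] exceed the radius [c * r] of a ball containing [E]. *)
have [m cm] : exists m, 2 * c ^+ 2 < 2 ^+ m.
  have /archi_boundP H : 0 <= 2 * c ^+ 2 by rewrite mulr_ge0// exprn_ge0// ltW.
  exists (Num.bound (2 * c ^+ 2)); apply: lt_trans H _.
  by rewrite -natrX ltr_nat ltn_expl.
(* The summands serve [1 <= M], the lower bound on [bdist], and the length [2 * Q ^+ m.+1 * s] of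
   the chain. *)
pose M := 1 + 2 * c + Q ^+ m.+1 / c.
have Qc0 : 0 <= Q ^+ m.+1 / c by rewrite divr_ge0 ?exprn_ge0// ltW.
exists M; first by rewrite /M; lra.
move=> E u v x r r0 cE Eu Ev Ex Ed.
have cr0 : 0 < r / (2 * c) by rewrite divr_gt0// mulr_gt0.
have cE2 : c * (r / (2 * c)) = r / 2 by field; rewrite gt_eqF.
apply: linked_sub (connected_linked (m := m) (x := x) X_doubling X_length
  cE Eu Ev _ cr0 (P := [set z | G z /\ r <= M * bdist G z]) _).
- by [].
- rewrite (_ : 2 * Q ^+ m.+1 * _ = Q ^+ m.+1 / c * r); last by field;
    rewrite gt_eqF.
  by rewrite ler_wpM2r ?ltW//; rewrite /M; lra.
- move=> z /Ex xz; rewrite ballEmdist/=; apply: le_lt_trans xz _.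
  rewrite mulrA ltr_pdivlMr ?mulr_gt0//.
  by rewrite (_ : c * r * (2 * c) = 2 * c ^+ 2 * r) ?ltr_pM2r//; ring.
- move=> w Ew z; rewrite ballEmdist/= => wz.
  have := bdist_lipschitz G_proper w z; have := Ed _ Ew => rw wz'.
  have : r < c * (bdist G z + r / (2 * c)).
    by apply: le_lt_trans rw _; rewrite ltr_pM2l//; lra.
  rewrite mulrDr cE2 => cz.
  have z0 : 0 < bdist G z.
    by rewrite -(pmulr_rgt0 _ c0); lra.
  split; first exact: bdist_gt0_in z0.
  have := mulr_ge0 Qc0 (ltW z0); rewrite /M; nra.
Qed.

(* The scales r, r/2, r/4, ... are followed until they are small compared to
   [bdist G x]; there a short curve from x, given by the length space, is
   used. *)
Lemma dyadic_carrot M rho x (A : R -> set X) : 1 <= M -> G x ->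
  (forall r, 0 < r <= rho -> A r !=set0) ->
  (forall r z, A r z -> mdist x z <= r) ->
  (forall r z z', 0 < r <= rho -> A (r / 2) z' -> A r z ->
     linked [set w | G w /\ r <= M * bdist G w] (M * r) z' z) ->
  forall r z, 0 < r <= rho -> A r z -> carrot G (2 * M ^+ 2) (2 * M * r) x z.
Proof.
move=> M1 Gx Ane Ax Alink r z rrho Arz.
have MM : 1 <= M * M by rewrite -[1]mulr1 ler_pM.
have d0 := bdist_gt0 G_proper G_open Gx.
have [n rn] : exists n, 4 * r <= 2 ^+ n * bdist G x.
  have /archi_boundP H : 0 <= 4 * r / bdist G x.
    by rewrite divr_ge0 ?mulr_ge0 ?ltW//; case/andP: rrho.
  exists (Num.bound (4 * r / bdist G x)).
  rewrite -ler_pdivrMr//; apply/ltW/(lt_trans H).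
  by rewrite -natrX ltr_nat ltn_expl.
elim: n r rn z rrho Arz => [|n IH] r rn z /andP[r0 rrho] Arz.
  apply: carrot_le (_ : 0 + 2 * r <= _) _; first exact: lexx.
    by rewrite add0r; nra.
  apply: carrot_extend.
    apply: carrot_refl => //; nra.
  (* Here [4 * r] is at most [bdist G x], so [bdist] is at least [2 * r] on the ball of radius
     [2 * r] about [x]. *)
  have xz : mdist x z < 2 * r by have := Ax r z Arz; lra.
  apply: linked_sub (length_space_linked X_length xz) => // w.
  rewrite ballEmdist/= => xw; have := bdist_lipschitz G_proper x w.
  rewrite expr0 mul1r in rn => xw'.
  have rw : 2 * r <= bdist G w by lra.
  split; first by apply: bdist_gt0_in; lra.
  by rewrite add0r expr2; nra.
have r20 : 0 < r / 2 <= rho by lra.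
have [z' Az'] := Ane _ r20.
have /IH/(_ _ r20 Az') cz' : 4 * (r / 2) <= 2 ^+ n * bdist G x.
  by move: rn; rewrite exprS; lra.
(* The lengths of the pieces sum as a geometric series. On the new piece [r <= M * bdist], which
   bounds the total by [2 * M ^+ 2 * bdist]. *)
rewrite (_ : 2 * M * r = 2 * M * (r / 2) + M * r); last by lra.
apply: carrot_extend cz' _.
have rr : 0 < r <= rho by rewrite r0.
apply: linked_sub (Alink r z z' rr Az' Arz) => // w [Gw rw]; split=> //.
have M0 : 0 <= M by lra.
have := ler_wpM2l M0 rw; rewrite expr2; lra.
Qed.

(** The link prolongs the first carrot to [v], with length [3 * M * rho]; this explains the constant
    [3 * M ^+ 2]. Joining the second carrot adds [2 * M * rho]. *)
Lemma carrots_linked_join M rho x y u v : 1 <= M -> 0 < rho ->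
  carrot G (2 * M ^+ 2) (2 * M * rho) x u ->
  carrot G (2 * M ^+ 2) (2 * M * rho) y v ->
  linked [set w | G w /\ rho <= M * bdist G w] (M * rho) u v ->
  exists a b g, [/\ rectifiable_curve_joining_in G x y a b g,
    (curve_length a b g <= (5 * M * rho)%:E)%E &
    forall t, t \in `[a, b] ->
      (Order.min (curve_length a t g) (curve_length t b g)
        <= (3 * M ^+ 2 * bdist G (g t))%:E)%E].
Proof.
move=> M1 rho0 cx cy uv.
have C23 : 2 * M ^+ 2 <= 3 * M ^+ 2 by rewrite ler_wpM2r ?exprn_ge0//; lra.
have cxv : carrot G (3 * M ^+ 2) (2 * M * rho + M * rho) x v.
  apply: carrot_extend (carrot_le C23 (lexx _) cx) _.
  apply: linked_sub uv => // w [Gw rw]; split=> //.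
  have M0 : 0 <= M by lra.
  by have := ler_wpM2l M0 rw; rewrite expr2; lra.
have := carrot_join cxv (carrot_le C23 (lexx _) cy).
by rewrite (_ : _ + _ + _ = 5 * M * rho); last by lra.
Qed.

End Domain.

(** * Diameters and subcurves *)

Section DiameterBounds.
Context {R : realType} {X : metricType R}.
Implicit Types (a b t : R) (g : R -> X) (u v x : X) (A G : set X).

Lemma mdist_le_diam A u v : A u -> A v -> ((mdist u v)%:E <= diam A)%E.
Proof. by move=> Au Av; apply: ereal_sup_ubound; exists (u, v). Qed.

Lemma diam_trace_le a b g : (diam (trace a b g) <= curve_length a b g)%E.
Proof.
apply: ge_ereal_sup => _ [[_ _] [/= [s sab <-] [t tab <-]] <-].
move: sab tab; rewrite /= !in_itv/= => /andP[as_ sb] /andP[at_ tb].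
have [st|/ltW ts] := leP s t; first exact: mdist_le_curve_length.
by rewrite metric_sym; exact: mdist_le_curve_length.
Qed.

Lemma is_curve_sub a b g a' b' : is_curve a b g ->
  a <= a' -> a' <= b' -> b' <= b -> is_curve a' b' g.
Proof.
move=> [ab cg] aa' ab' bb'; split=> //; apply: continuous_subspaceW cg => t /=.
by rewrite !in_itv/= => /andP[/(le_trans aa')-> /le_trans->].
Qed.

Lemma connected_trace a b g : is_curve a b g -> connected (trace a b g).
Proof.
by move=> [_ cg]; apply: connected_continuous_connected cg;
  exact: segment_connected.
Qed.

(** Settles [x = y], where there is no positive distance to set the scale. *)
Lemma trivial_length_curve G C x : 0 <= C -> G x -> exists a b g,
  [/\ rectifiable_curve_joining_in G x x a b g, curve_length a b g = 0%E &
    forall t, t \in `[a, b] ->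
      (Order.min (curve_length a t g) (curve_length t b g)
        <= (C * bdist G (g t))%:E)%E].
Proof.
move=> C0 Gx; exists 0, 0, (cst x); rewrite curve_lengthxx; split=> //.
  split; last by move=> _ [t _ <-].
  by split=> //; [exact: is_curve_cst|rewrite /rectifiable curve_lengthxx].
move=> t; rewrite in_itv/= => t0; have -> : t = 0 by apply/le_anti;
  rewrite andbC.
by rewrite curve_lengthxx minxx lee_fin mulr_ge0// bdist_ge0.
Qed.

End DiameterBounds.

(** * Implications between the John conditions and between the uniformity conditions *)

Section Main.
Context {R : realType} {X : metricType R} (Q : R) (G : set X).
Hypotheses (Q_ge0 : 0 <= Q) (X_doubling : doubling Q X).
Hypothesis X_length : length_space X.
Hypotheses (G_open : open G) (G_proper : G `<` [set: X]).

Let dyadic := dyadic_carrot X_length G_open G_proper.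

Lemma diam_john_length_john : diam_john G -> length_john G.
Proof.
(* The factor 8 is for the middle piece, which lies within [8 * rho] of [x]. *)
move=> [c c1 Gc]; have c0 : 0 < 8 * c by lra.
have [M M1 HM] := bounded_turning_linked Q_ge0 X_doubling X_length G_proper c0.
have half a b g rho : is_curve a b g -> G (g a) -> 0 < rho ->
    mdist (g a) (g b) = rho ->
    {in `[a, b], forall t, mdist (g a) (g t) <= rho} ->
    (forall t t', a <= t' -> t' <= t -> t <= b ->
       mdist (g a) (g t') <= c * bdist G (g t)) ->
    carrot G (2 * M ^+ 2) (2 * M * rho) (g a) (g b).
  move=> cg Gga rho0 gb gle gd.
  (* Points at distance [r] up to which the curve stays within [r]; hence their times increase with
     [r], and the subcurve between two scales can serve as [E]. *)
  pose A r := [set g t | t in [set t | t \in `[a, b] /\ mdist (g a) (g t) = r /\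
    {in `[a, t], forall t', mdist (g a) (g t') <= r}]].
  apply: (@dyadic M rho _ A) => //.
  - move=> r /andP[r0 rr].
    have [|t tab [tr tle]] := @first_hitting _ _ a b g (g a) r cg.
      by rewrite mdistxx gb rr ltW.
    by exists (g t), t.
  - by move=> r _ [t [_ [tr _]] <-]; rewrite tr.
  - move=> r _ _ /andP[r0 rr] [t' [t'ab [tr' tle']] <-] [t [tab [tr tle]] <-].
    move: (t'ab) (tab); rewrite !in_itv/= => /andP[at' t'b] /andP[at_ tb].
    have tt : t' <= t.
      rewrite leNgt; apply/negP => tt'; have := tle' t;
        rewrite in_itv/= at_ ltW//.
      by move=> /(_ isT); lra.
    apply: (HM (trace t' t g) _ _ (g a)) => //.
    + exact: connected_trace (is_curve_sub cg at' tt tb).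
    + by exists t'; rewrite //= in_itv/= lexx.
    + by exists t; rewrite //= in_itv/= lexx tt.
    + move=> _ [s /= + <-]; rewrite in_itv/= => /andP[t's st].
      have := tle s; rewrite in_itv/= st (le_trans at' t's) => /(_ isT); nra.
    + move=> _ [s /= + <-]; rewrite in_itv/= => /andP[t's st].
      have := gd s t' at' t's (le_trans st tb); rewrite tr'; lra.
  - by rewrite rho0 lexx.
  - exists b => //; split; last by [].
    by rewrite in_itv/= lexx cg.1.
exists (3 * M ^+ 2); first by rewrite expr2; nra.
move=> x y Gx Gy; have [<-|/eqP xy] := eqVneq x y.
  have [|a [b [g [jg _ lg]]]] :=
    @trivial_length_curve _ _ G (3 * M ^+ 2) x _ Gx.
    by rewrite mulr_ge0// exprn_ge0//; lra.
  by exists a, b, g.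
have [a [b [g [[[cg rg [ga gb]] trg] dg]]]] := Gc x y Gx Gy.
have ab := cg.1.
have aab : a \in `[a, b] by rewrite in_itv/= lexx.
have bab : b \in `[a, b] by rewrite in_itv/= lexx ab.
(* Up to a factor 2, [g m] is farthest from [x]. The scale is set by the size of the curve, since a
   John curve may be much larger than [mdist x y]. *)
have [m mab [xm mmax]] : exists2 m, m \in `[a, b] & 0 < mdist x (g m) /\
    {in `[a, b], forall t, mdist x (g t) <= 2 * mdist x (g m)}.
  pose D := [set mdist x (g t) | t in `[a, b]].
  have lfin : curve_length a b g \is a fin_num.
    by rewrite ge0_fin_numE// curve_length_ge0.
  have ubD : ubound D (fine (curve_length a b g)).
    move=> _ [t /= + <-]; rewrite in_itv/= => /andP[at_ tb].
    by rewrite -lee_fin fineK// -ga mdist_le_curve_length.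
  have sD : has_sup D.
    by split; [exists (mdist x (g b)), b|exists (fine (curve_length a b g))].
  have D0 : 0 < sup D.
    apply: lt_le_trans (_ : mdist x y <= _); first by rewrite mdist_gt0;
      exact/eqP.
    by apply: ub_le_sup; [case: sD|exists b; rewrite ?gb].
  have [|_ [m mab <-] mD] := @sup_adherent _ D (sup D / 2) _ sD; first by lra.
  exists m => //; split=> [|t tab]; first by lra.
  have : mdist x (g t) <= sup D by apply: ub_le_sup; [case: sD|exists t].
  lra.
move: (mab); rewrite in_itv/= => /andP[am mb].
pose rho := mdist x (g m) / 4.
have rho0 : 0 < rho by rewrite /rho; lra.
(* Both subcurves at [g t] then have diameter at least [r], whichever of them attains the
   minimum. *)
have low t t1 t2 r : a <= t1 -> t1 <= t -> t <= t2 -> t2 <= b ->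
    r <= mdist x (g t1) -> r <= mdist y (g t2) -> r <= c * bdist G (g t).
  move=> at1 t1t tt2 t2b r1 r2; rewrite -lee_fin.
  have at_ := le_trans at1 t1t; have tb := le_trans tt2 t2b.
  apply: le_trans (dg t _); last by rewrite in_itv/= at_.
  rewrite le_min; apply/andP; split.
    apply: le_trans (_ : (mdist x (g t1))%:E <= _)%E; first by rewrite lee_fin.
    rewrite -ga; apply: mdist_le_diam; first by exists a;
      rewrite //= in_itv/= lexx.
    by exists t1; rewrite //= in_itv/= at1.
  apply: le_trans (_ : (mdist y (g t2))%:E <= _)%E; first by rewrite lee_fin.
  rewrite -gb; apply: mdist_le_diam; first by exists b;
    rewrite //= in_itv/= lexx tb.
  by exists t2; rewrite //= in_itv/= tt2.
have [s + [xs sle]] : exists2 s, s \in `[a, m] &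
    mdist x (g s) = rho /\ {in `[a, s], forall t, mdist x (g t) <= rho}.
  apply: first_hitting; first exact: is_curve_sub cg _ am mb.
  by rewrite ga mdistxx /rho; lra.
rewrite in_itv/= => /andP[as_ sm].
have [s' + [ys sle']] : exists2 s, s \in `[a, b] &
    mdist y (g s) = rho /\ {in `[s, b], forall t, mdist y (g t) <= rho}.
  (* If [x] is within [rho] of [y], then [g m], at distance [4 * rho] from [x], is far from [y]. *)
  have [p [ap pb yp]] : exists p, [/\ a <= p, p <= b & rho <= mdist y (g p)].
    have := metric_triangle x y (g m) => tri.
    have [yx|yx] := leP rho (mdist y x); first by exists a; rewrite ga.
    by exists m; split=> //; move: yx tri; rewrite (metric_sym y x) /rho; lra.
  have := is_curve_rev (is_curve_sub cg ap pb (lexx _)).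
  move=> /first_hitting-/(_ y rho)[|q qab [qE qle]].
    by rewrite /= !opprK gb mdistxx yp ltW.
  exists (- q); first by move: qab; rewrite !in_itv/=; lra.
  split=> // t; rewrite in_itv/= => tsb; have := qle (- t).
  by rewrite /= opprK; apply; rewrite in_itv/=; lra.
rewrite in_itv/= => /andP[as' s'b].
have ss' : s <= s'.
  (* Otherwise [g s] and [g m] both lie within [rho] of [y], which puts [g m] within [3 * rho] of
     [x]. *)
  rewrite leNgt; apply/negP => s's.
  have sb := le_trans sm mb.
  have := sle' s; rewrite in_itv/= (ltW s's) sb => /(_ isT) ysr.
  have := sle' m; rewrite in_itv/= (le_trans (ltW s's) sm) mb => /(_ isT) ymr.
  have := metric_triangle x (g s) (g m); have := metric_triangle (g s) y (g m).
  by rewrite (metric_sym (g s) y) xs; move: ysr ymr; rewrite /rho; lra.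
have sb := le_trans ss' s'b.
have cx : carrot G (2 * M ^+ 2) (2 * M * rho) x (g s).
  rewrite -ga; apply: half => //; rewrite ?ga//.
    exact: is_curve_sub cg _ _ _.
  move=> t t' at' t't ts; apply: (low t t' s') => //; first exact: le_trans ss'.
  by rewrite ys; apply: sle; rewrite in_itv/= at' (le_trans t't).
have cy : carrot G (2 * M ^+ 2) (2 * M * rho) y (g s').
  have := half (- b) (- s') (g \o -%R) rho.
  rewrite /= !opprK gb; apply=> //.
  - exact: is_curve_rev (is_curve_sub cg as' s'b (lexx _)).
  - by move=> t tb; apply: sle'; move: tb; rewrite !in_itv/=; lra.
  - move=> t t' bt' t't ts'; apply: (low (- t) s (- t')) => //; try lra.
    by rewrite xs; apply: sle'; rewrite in_itv/=; lra.
have sslink :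
    linked [set w | G w /\ rho <= M * bdist G w] (M * rho) (g s) (g s').
  apply: (HM (trace s s' g) _ _ x) => //.
  - exact: connected_trace (is_curve_sub cg as_ ss' s'b).
  - by exists s; rewrite //= in_itv/= lexx.
  - by exists s'; rewrite //= in_itv/= lexx ss'.
  - move=> _ [t /= + <-]; rewrite in_itv/= => /andP[st ts'].
    have := mmax t;
      rewrite in_itv/= (le_trans as_ st) (le_trans ts' s'b) => /(_ isT).
    have : rho <= c * rho by rewrite ler_peMl// ltW.
    by rewrite /rho; lra.
  - move=> _ [t /= + <-]; rewrite in_itv/= => /andP[st ts'].
    have : rho <= c * bdist G (g t).
      by apply: (low t s s') => //; rewrite ?xs ?ys.
    by lra.
have [a' [b' [g' [jg' _ lg']]]] := carrots_linked_join M1 rho0 cx cy sslink.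
by exists a', b', g'.
Qed.

Lemma dist_uniform_length_uniform : dist_uniform G -> length_uniform G.
Proof.
move=> [c c1 Gc]; have c0 : 0 < 4 * c ^+ 2 by rewrite mulr_gt0// exprn_gt0//;
  lra.
have cc : c <= c * c by rewrite ler_peMr//; lra.
have [M M1 HM] := bounded_turning_linked Q_ge0 X_doubling X_length G_proper c0.
(* The curve from [u] to [v] has diameter at most [4 * c * r]. Within [r / (4 * c)] of an end, the
   Lipschitz property keeps [bdist] at least [r / (4 * c)]; elsewhere the distance condition gives
   [r / (4 * c ^+ 2)]. *)
have link u v r : 0 < r -> G u -> G v -> r <= 2 * c * bdist G u ->
    r <= 2 * c * bdist G v -> mdist u v <= 4 * r ->
    linked [set w | G w /\ r <= M * bdist G w] (M * r) u v.
  move=> r0 Gu Gv ru rv uv.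
  have [a [b [g [[[cg _ [ga gb]] _] diamg mg]]]] := Gc u v Gu Gv.
  apply: (HM (trace a b g) _ _ u) => //.
  - exact: connected_trace.
  - by exists a; rewrite //= in_itv/= lexx cg.1.
  - by exists b; rewrite //= in_itv/= lexx cg.1.
  - move=> z trz; apply: (@le_trans _ _ (c * mdist u v));
      last by rewrite expr2; nra.
    rewrite -lee_fin; apply: le_trans diamg; apply: mdist_le_diam => //.
    by exists a; rewrite //= in_itv/= lexx cg.1.
  - move=> _ [t /= /mg mt <-]; set z := g t in mt *.
    have z0 := bdist_ge0 G z.
    have near w : r <= 2 * c * bdist G w -> 4 * c * mdist w z <= r ->
        r <= 4 * c ^+ 2 * bdist G z.
      move=> rw wz; have := bdist_lipschitz G_proper w z => wz'.
      have : r <= 2 * c * (bdist G z + mdist w z).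
        by apply: le_trans rw _; rewrite ler_pM2l//; lra.
      rewrite mulrDr => H; have : r <= 4 * (c * bdist G z) by lra.
      have := ler_wpM2r z0 cc; rewrite expr2; lra.
    have [/near|uz] := leP (4 * c * mdist u z) r; first exact.
    have [|vz] := leP (4 * c * mdist v z) r; first exact: near.
    have : 4 * c * Order.min (mdist u z) (mdist z v) <= 4 * c * (c * bdist G z).
      by rewrite ler_pM2l//; lra.
    by rewrite expr2 /Order.min; case: ifP => _; rewrite ?(metric_sym z v); lra.
(* The first summand is for the condition along the curve, the second for its length. *)
exists (3 * M ^+ 2 + 5 * M); first by rewrite expr2; nra.
move=> x y Gx Gy; have [<-|xy] := eqVneq x y.
  have [|a [b [g [jg lg lt_g]]]] :=
    @trivial_length_curve _ _ G (3 * M ^+ 2 + 5 * M) x _ Gx.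
    by rewrite addr_ge0 ?mulr_ge0 ?exprn_ge0//; lra.
  by exists a, b, g; rewrite lg mdistxx mulr0.
pose A p r := [set z | [/\ G z, mdist p z = r & r <= c * bdist G z]].
(* For [r] at most half of [mdist p q], a point at distance [r] from [p] is at least as far from
   [q], so the minimum in the distance condition is [r]. *)
have hit p q r : G p -> G q -> 0 < r <= mdist p q / 2 -> A p r !=set0.
  move=> Gp Gq /andP[r0 rpq].
  have [a [b [g [[[cg _ [ga gb]] trg] _ mg]]]] := Gc p q Gp Gq.
  have [|t tab [tr _]] := @first_hitting _ _ a b g p r cg.
    by rewrite ga gb mdistxx; lra.
  exists (g t); split=> //; first by apply: trg; exists t.
  apply: le_trans (mg t tab); rewrite le_min tr lexx /=.
  have := metric_triangle p (g t) q; lra.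
have half p q : G p -> G q -> p != q -> forall z, A p (mdist p q / 2) z ->
    carrot G (2 * M ^+ 2) (2 * M * (mdist p q / 2)) p z.
  move=> Gp Gq; rewrite -mdist_gt0 => pq z.
  apply: (@dyadic M (mdist p q / 2) p (A p)) => //.
  - by move=> r; exact: hit.
  - by move=> r w [_ -> _].
  (* The point [w'] belongs to the scale [r / 2], which is why [link] allows the constant
     [2 * c]. *)
  - move=> r w' w /andP[r0 rpq] [Gw pw wd] [Gw' pw' wd'].
    have dw' := bdist_ge0 G w'; apply: link => //; first by lra.
      have : 0 <= c * bdist G w' by lra.
      by lra.
    have := metric_triangle w p w'; rewrite (metric_sym w p); lra.
  - by lra.
have xy0 : 0 < mdist x y by rewrite mdist_gt0.
have r0 : 0 < mdist x y / 2 by lra.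
have yx : y != x by rewrite eq_sym.
have [|u Au] := hit x y (mdist x y / 2) Gx Gy; first by rewrite r0 lexx.
have [|v Av] := hit y x (mdist y x / 2) Gy Gx.
  by rewrite (metric_sym y x) r0 lexx.
have cx := half x y Gx Gy xy u Au; have cy := half y x Gy Gx yx v Av.
rewrite (metric_sym y x) in Av cy.
have [] := carrots_linked_join M1 r0 cx cy.
  case: Au Av => [Gu xu ud] [Gv yv vd].
  (* With [r] half of [mdist x y], the path through [x] and [y] gives distance at most
     [r + 2 * r + r]. *)
  apply: link => //; [lra|lra|].
  have := metric_triangle u x v; have := metric_triangle x y v.
  by rewrite (metric_sym u x); lra.
move=> a [b [g [jg lg mg]]]; exists a, b, g; split=> //.
  apply: le_trans lg _; rewrite lee_fin.
  by rewrite expr2; have := sqr_ge0 M; rewrite expr2; nra.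
move=> t /mg/le_trans; apply; rewrite lee_fin ler_wpM2r ?bdist_ge0//; lra.
Qed.

Lemma length_john_diam_john : length_john G -> diam_john G.
Proof.
move=> [c c1 Gc]; exists c => // x y Gx Gy.
have [a [b [g [jg mg]]]] := Gc x y Gx Gy; exists a, b, g; split=> // t /mg.
by apply: le_trans; rewrite le_min !ge_min !diam_trace_le orbT.
Qed.

Lemma length_uniform_diam_uniform : length_uniform G -> diam_uniform G.
Proof.
move=> [c c1 Gc]; exists c => // x y Gx Gy.
have [a [b [g [jg lg mg]]]] := Gc x y Gx Gy; exists a, b, g; split=> //.
  exact: le_trans (diam_trace_le a b g) lg.
move=> t /mg; by apply: le_trans; rewrite le_min !ge_min !diam_trace_le orbT.
Qed.

(** Each subcurve at [g t] contains [g t] and an endpoint, so its diameter bounds their distance. *)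
Lemma diam_uniform_dist_uniform : diam_uniform G -> dist_uniform G.
Proof.
move=> [c c1 Gc]; exists c => // x y Gx Gy.
have [a [b [g [jg dg mg]]]] := Gc x y Gx Gy; exists a, b, g; split=> // t tab.
have [[_ _ [ga gb]] _] := jg.
rewrite -lee_fin; apply: le_trans (mg t tab).
move: tab; rewrite in_itv/= => /andP[at_ tb].
have ta : trace a t g (g t) by exists t; rewrite //= in_itv/= at_ lexx.
have tb' : trace t b g (g t) by exists t; rewrite //= in_itv/= tb lexx.
have xa : trace a t g x by exists a; rewrite //= in_itv/= at_ lexx.
have yb : trace t b g y by exists b; rewrite //= in_itv/= tb lexx.
rewrite le_min; apply/andP; split.
  by apply: le_trans (mdist_le_diam xa ta); rewrite lee_fin ge_min lexx.
by apply: le_trans (mdist_le_diam tb' yb); rewrite lee_fin ge_min lexx orbT.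
Qed.

End Main.

Theorem corollary1p3 (R : realType) (X : metricType R) (Q : R)
    (Q_gt1 : 1 < Q) (X_doubling : doubling Q X) (X_length : length_space X)
    (G : set X) (G_domain : domain G) (G_proper : G `<` [set: X]) :
  (length_john G <-> diam_john G) /\
  ((length_uniform G <-> diam_uniform G) /\
   (diam_uniform G <-> dist_uniform G)).
Proof.
have [_ G_open _] := G_domain.
have Q_ge0 : 0 <= Q by lra.
(* Closes the cycle from length to diameter to distance uniformity and back to length. *)
have dist_length := dist_uniform_length_uniform Q_ge0 X_doubling X_length
  G_open G_proper.
split; [|split]; split.
- exact: length_john_diam_john.
- exact: diam_john_length_john Q_ge0 X_doubling X_length G_open G_proper.
- exact: length_uniform_diam_uniform.
- by move=> /diam_uniform_dist_uniform.
- exact: diam_uniform_dist_uniform.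
- by move=> /dist_length; exact: length_uniform_diam_uniform.
Qed.
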